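(* Let $n\ge 2$ and let $f:\mathbb{R}^n_+\to\mathbb{R}_+$ be a quasi-sum production function, i.e. a twice differentiable function of the form $f(x)=G(h_1(x_1)+\ldots+h_n(x_n))$ for $x=(x_1,\ldots,x_n)\in\mathbb{R}^n_+$, where $G,h_1,\ldots,h_n$ are strictly monotone functions with $G'>0$. Then: (i) For a given index $i$ and a constant $k_i$, the elasticity of production with respect to the factor $x_i$ is the constant $k_i$ if and only if $f$ reduces to $$f(x_1,\ldots,x_n)=A\cdot x_i^{k_i}\cdot\exp\Big(D\sum_{j\neq i}h_j(x_j)\Big),$$ where $A$ and $D$ are positive constants. (ii) The elasticity of production is a constant $k_i$ with respect to every factor of production $x_i$, $i=1,\ldots,n$, if and only if $f$ reduces to the generalized Cobb-Douglas production function $$f(x_1,\ldots,x_n)=A\cdot\prod_{i=1}^n x_i^{\alpha_i},$$ where $A,\alpha_1,\ldots,\alpha_n>0$. (iii) $f$ satisfies the proportional marginal rate of substitution property if and only if it reduces to the homothetic generalized Cobb-Douglas production function $$f(x_1,\ldots,x_n)=F\Big(\prod_{i=1}^n x_i^k\Big),$$ where $k$ is a nonzero real number and $F$ is a strictly increasing function. (iv) If $f$ satisfies the proportional marginal rate of substitution property, then: (iv$_1$) The production hypersurface of $f$ has vanishing Gauss-Kronecker curvature if and only if, up to a suitable translation (that is, up to adding a real constant to $f$), $f$ reduces to the generalized Cobb-Douglas production function with constant return to scale $$f(x_1,\ldots,x_n)=A\cdot\prod_{i=1}^n x_i^{1/n},$$ where $A>0$ is a constant. (iv$_2$) The production hypersurface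 of $f$ cannot be minimal. (iv$_3$) The production hypersurface of $f$ has vanishing sectional curvature, i.e. $K_{ij}=0$ identically for all $i\ne j$, if and only if, up to a suitable translation (that is, up to adding a real constant to $f$), $f$ reduces to the generalized Cobb-Douglas production function $$f(x_1,\ldots,x_n)=A\cdot\prod_{i=1}^n\sqrt{x_i},$$ where $A>0$ is a constant.
   Context: $\mathbb{R}_+=(0,\infty)$ denotes the positive reals. A production function with $n$ inputs is a twice differentiable map $f:\mathbb{R}^n_+\to\mathbb{R}_+$, $f=f(x_1,\ldots,x_n)$; subscripts $f_{x_i}$, $f_{x_ix_j}$ denote partial derivatives. The elasticity of production with respect to the factor $x_i$ is $E_{x_i}=\frac{x_i}{f}f_{x_i}$ (a function on $\mathbb{R}^n_+$; ''is a constant $k_i$'' means it is identically equal to $k_i$). The marginal rate of technical substitution of input $x_j$ for input $x_i$ is ${\rm MRS}_{ij}=\frac{f_{x_j}}{f_{x_i}}$. The function $f$ satisfies the proportional marginal rate of substitution property if ${\rm MRS}_{ij}=\frac{x_i}{x_j}$ for all $1\le i\ne j\le n$ on $\mathbb{R}^n_+$. A production function is homothetic if it has the form $\Phi(h(x_1,\ldots,x_n))$ with $\Phi$ strictly increasing and $h$ homogeneous of some degree $p$. The production hypersurface of $f$ is its graph, the nonparametric hypersurface of Euclidean space $\mathbb{E}^{n+1}$ given by $L(x_1,\ldots,x_n)=(x_1,\ldots,x_n,f(x_1,\ldots,x_n))$, with the metric induced from the Euclidean metric. The shape operator of a hypersurface $M$ is defined by $g(S_pv,w)=g(d\nu(v),w)$,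 where $\nu$ is the Gauss map (unit normal) and $g$ is the induced metric. The Gauss-Kronecker curvature $K$ is the determinant of the shape operator, and the mean curvature $H$ is given (up to normalization) by its trace; the hypersurface is minimal if $H$ vanishes identically. With $w=\sqrt{1+\sum_{i=1}^n f_{x_i}^2}$, for the production hypersurface one has $$K=\frac{\det(f_{x_ix_j})}{w^{n+2}},\qquad H=\frac1n\sum_{i=1}^n\frac{\partial}{\partial x_i}\Big(\frac{f_{x_i}}{w}\Big),$$ and the sectional curvature of the plane section spanned by $\frac{\partial}{\partial x_i},\frac{\partial}{\partial x_j}$ ($i\neq j$) is $$K_{ij}=\frac{f_{x_ix_i}f_{x_jx_j}-f_{x_ix_j}^2}{w^2(1+f_{x_i}^2+f_{x_j}^2)}.$$
   Formalization: In (ii), since f = x_2/x_1 has constant elasticities -1 and 1, the claim is split: the elasticities are positive constants iff f = A prod x_i^{alpha_i} with all alpha_i > 0; they are constants of any sign iff f has this form with all alpha_i nonzero. *)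

(* Defs.v *)
From HB Require Import structures.
From mathcomp Require Import all_boot all_order all_algebra.
From mathcomp Require Import all_classical all_reals all_analysis.
From mathcomp Require Import ring.

Set Implicit Arguments.
Unset Strict Implicit.
Unset Printing Implicit Defensive.

Import Order.TTheory GRing.Theory Num.Theory.
Import numFieldNormedType.Exports.

Local Open Scope classical_set_scope.
Local Open Scope ring_scope.

Section production.
Context {R : realType} {n : nat}.
Implicit Types (f : 'rV[R]_n -> R) (x : 'rV[R]_n) (i j : 'I_n).

Definition orthant : set 'rV[R]_n := [set x | forall i, 0 < x 0 i].

Definition partial i f : 'rV[R]_n -> R := fun x => 'D_(delta_mx 0 i) f x.

Definition grad f x : 'rV[R]_n := \row_i partial i f x.

(* The values of [f] outside the orthant are irrelevant.  The orthant is open,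
   so [differentiable] (Frechet differentiability in 'rV[R]_n) and [partial]
   only see [f] on the orthant. *)
Definition production_function f : Prop :=
  [/\ forall x, orthant x -> 0 < f x,
      forall x, orthant x -> differentiable f x
    & forall i x, orthant x -> differentiable (partial i f) x].

Definition strictly_monotone (D : set R) (g : R -> R) : Prop :=
  (forall u v, D u -> D v -> u < v -> g u < g v) \/
  (forall u v, D u -> D v -> u < v -> g v < g u).

(* [G] is only required to be defined on an open interval [J] containing all the
   values of h_1(x_1) + ... + h_n(x_n). *)
Definition quasi_sum (G : R -> R) (h : 'I_n -> R -> R) f : Prop :=
  exists J : set R,
    [/\ open J /\ is_interval J,
        strictly_monotone J G,
        forall u, J u -> derivable G u 1 /\ 0 < 'D_1 G u,
        forall i, strictly_monotone [set t | 0 < t] (h i)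
      & forall x, orthant x ->
          J (\sum_(i < n) h i (x 0 i)) /\ f x = G (\sum_(i < n) h i (x 0 i))].

Definition elasticity i f x : R := x 0 i / f x * partial i f x.

Definition constant_elasticity i f (k : R) : Prop :=
  forall x, orthant x -> elasticity i f x = k.

Definition MRS i j f x : R := partial j f x / partial i f x.

(* Since a / 0 = 0 while x_i / x_j > 0, this forces all the partial derivatives
   to be nonzero, so that every MRS is a genuine quotient. *)
Definition proportional_MRS f : Prop :=
  forall i j, i != j -> forall x, orthant x -> MRS i j f x = x 0 i / x 0 j.

Definition graph_immersion f x : 'rV[R]_(n + 1) := row_mx x (f x)%:M.

Definition normal_norm f x : R :=
  Num.sqrt (1 + \sum_(i < n) partial i f x ^+ 2).

(* The unit normal (grad f, -1) / w.  With S = d nu (no minus sign) this is the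
   orientation for which det S = det (f_ij) / w^(n+2) and
   tr S = \sum_i d/dx_i (f_i / w). *)
Definition gauss_map f x : 'rV[R]_(n + 1) :=
  (normal_norm f x)^-1 *: row_mx (grad f x) (-1)%:M.

(* Row i of the Jacobian 'J F x is dF(d/dx_i), so the entries of the next two
   matrices are <L_i, L_j> and <d nu (d/dx_i), L_j>, where L_i denotes
   dL(d/dx_i). *)
Definition first_form f x : 'M[R]_n :=
  'J (graph_immersion f) x *m ('J (graph_immersion f) x)^T.

Definition second_form f x : 'M[R]_n :=
  'J (gauss_map f) x *m ('J (graph_immersion f) x)^T.

(* The matrix, acting on row vectors of coordinates in the basis (L_i), of the
   shape operator: see [shape_operatorP]. *)
Definition shape_operator f x : 'M[R]_n :=
  second_form f x *m invmx (first_form f x).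

Definition gauss_kronecker f x : R := \det (shape_operator f x).

Definition mean_curvature f x : R := n%:R^-1 * \tr (shape_operator f x).

Definition minimal_hypersurface f : Prop :=
  forall x, orthant x -> mean_curvature f x = 0.

(* Sectional curvature of the plane spanned by L_i and L_j in the induced
   metric, in the form given by the Gauss equation (as f is only twice
   differentiable, the metric has no curvature tensor of its own). *)
Definition sectional_curvature i j f x : R :=
  let g := first_form f x in
  let b := second_form f x in
  (b i i * b j j - b i j ^+ 2) / (g i i * g j j - g i j ^+ 2).

Lemma differentiable_rV m (F : 'rV[R]_n -> 'rV[R]_m) x :
  (forall j : 'I_m, differentiable (fun y => F y 0 j) x) -> differentiable F x.
Proof.
move=> dF.
have -> : F = \sum_(j < m) (fun y => F y 0 j *: delta_mx 0 j).
  by apply/funext => y; rewrite fct_sumE [LHS]row_sum_delta.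
apply: differentiable_sum => j; exact: differentiableZl.
Qed.

Lemma jacobianE m (F : 'rV[R]_n -> 'rV[R]_m) x :
  (forall j : 'I_m, differentiable (fun y => F y 0 j) x) ->
  'J F x = \matrix_(i, j) partial i (fun y => F y 0 j) x.
Proof.
move=> /differentiable_rV dF; apply/row_matrixP => i.
rewrite rowE -deriveEjacobian// derive_mx; last exact: diff_derivable.
by apply/rowP => j; rewrite !mxE.
Qed.

Lemma partial_coord i k x : partial i (fun y => y 0 k) x = (i == k)%:R.
Proof.
have := @derive_id R 'rV[R]_n x (delta_mx 0 i).
rewrite derive_mx; last exact: derivable_id.
by move=> /rowP/(_ k); rewrite !mxE eqxx /= eq_sym.
Qed.

Lemma jacobian_graph f x : differentiable f x ->
  'J (graph_immersion f) x = row_mx 1%:M (grad f x)^T.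
Proof.
move=> df; have lE k : (fun y => graph_immersion f y 0 (lshift 1 k)) =
    (fun y => y 0 k) by apply/funext => y; rewrite row_mxEl.
have rE k : (fun y => graph_immersion f y 0 (rshift n k)) = f.
  by apply/funext => y; rewrite row_mxEr mxE ord1 eqxx mulr1n.
rewrite jacobianE => [|j].
  apply/matrixP => i j; rewrite mxE; case: (split_ordP j) => k ->.
    by rewrite lE row_mxEl partial_coord mxE.
  by rewrite rE row_mxEr !mxE.
case: (split_ordP j) => k ->; first by rewrite lE; exact: differentiable_coord.
by rewrite rE.
Qed.

Lemma first_formE f x : differentiable f x ->
  first_form f x = 1%:M + (grad f x)^T *m grad f x.
Proof.
move=> df; rewrite /first_form jacobian_graph// tr_row_mx mul_row_col.
by rewrite trmx1 trmxK mul1mx.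
Qed.

Lemma first_form_unit f x : differentiable f x -> first_form f x \in unitmx.
Proof.
move=> df; rewrite -row_free_unit -kermx_eq0; apply/rowV0P => v /sub_kermxP vg0.
have : (v *m 'J (graph_immersion f) x) *m (v *m 'J (graph_immersion f) x)^T = 0.
  by rewrite trmx_mul mulmxA -[in LHS](mulmxA v) -/(first_form f x) vg0 mul0mx.
rewrite jacobian_graph// mul_mx_row mulmx1 => /matrixP/(_ 0 0).
rewrite !mxE; under eq_bigr do rewrite [X in _ * X]mxE -expr2.
move=> /eqP; rewrite psumr_eq0 => [/allP sq0|? _]; last exact: sqr_ge0.
apply/rowP => j; rewrite mxE.
have := sq0 (lshift 1 j) (mem_index_enum _).
by rewrite row_mxEl sqrf_eq0 => /eqP.
Qed.

(* g(S v, w) = g(d nu (v), w) for tangent vectors with coordinates v and w. *)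
Lemma shape_operatorP f x (v w : 'rV[R]_n) : differentiable f x ->
  (v *m shape_operator f x) *m first_form f x *m w^T =
  (v *m 'J (gauss_map f) x) *m (w *m 'J (graph_immersion f) x)^T.
Proof.
move=> df; rewrite /shape_operator -(mulmxA v) -(mulmxA (second_form f x)).
by rewrite mulVmx ?first_form_unit// mulmx1 trmx_mul !mulmxA.
Qed.

Lemma normal_norm_gt0 f x : 0 < normal_norm f x.
Proof.
by rewrite sqrtr_gt0 ltr_pwDl// sumr_ge0// => i _; exact: sqr_ge0.
Qed.

Lemma gauss_map_unit f x : gauss_map f x *m (gauss_map f x)^T = 1%:M.
Proof.
have w2 : normal_norm f x ^+ 2 = 1 + \sum_(i < n) partial i f x ^+ 2.
  by rewrite sqr_sqrtr// addr_ge0// sumr_ge0// => i _; exact: sqr_ge0.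
rewrite /gauss_map [(_ *: _)^T]linearZ -scalemxAl -scalemxAr scalerA.
rewrite /= tr_row_mx mul_row_col; apply/matrixP => i j.
rewrite !ord1 mxE [X in _ * X]mxE mxE.
under eq_bigr do rewrite !mxE -expr2.
rewrite mul_scalar_mx !mxE !eqxx !mulr1n mulrNN mulr1 [_ + 1]addrC -w2.
by rewrite -expr2 exprVn mulVf// expf_neq0// gt_eqF// normal_norm_gt0.
Qed.

Lemma gauss_map_normal f x : differentiable f x ->
  gauss_map f x *m ('J (graph_immersion f) x)^T = 0.
Proof.
move=> df; rewrite jacobian_graph// tr_row_mx trmx1 trmxK.
rewrite /gauss_map -scalemxAl mul_row_col mulmx1 mul_scalar_mx scaleN1r.
by rewrite subrr scaler0.
Qed.

Lemma second_formE f i j x : production_function f -> orthant x ->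
  second_form f x i j = partial i (partial j f) x / normal_norm f x.
Proof.
move=> [_ df d2f] ox.
have dfx := df _ ox; have d2fx k := d2f k _ ox.
pose u y := (normal_norm f y)^-1.
have du : differentiable u x.
  apply: differentiableV; last by rewrite gt_eqF// normal_norm_gt0.
  apply: (@differentiable_comp _ _ _ _
    (fun y => 1 + \sum_(i < n) partial i f y ^+ 2) Num.sqrt).
    apply: differentiableD => //.
    rewrite (_ : (fun _ => _) = \sum_(k < n) (fun y => partial k f y ^+ 2)).
      by apply: differentiable_sum => k; apply: differentiableM.
    by apply/funext => y; rewrite fct_sumE.
  apply/derivable1_diffP; apply: ex_derive; apply: is_derive1_sqrt.
  by rewrite ltr_pwDl// sumr_ge0// => k _; exact: sqr_ge0.
have lE k : (fun y => gauss_map f y 0 (lshift 1 k)) = u * partial k f.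
  by apply/funext => y; rewrite mxE row_mxEl mxE.
have rE k : (fun y => gauss_map f y 0 (rshift n k)) = - u.
  by apply/funext => y; rewrite mxE row_mxEr mxE ord1 eqxx mulr1n mulrN1.
have dE : differentiable (- u) x by exact: differentiableN.
rewrite /second_form jacobian_graph// jacobianE; last first.
  move=> k; case: (split_ordP k) => l ->; last by rewrite rE.
  by rewrite lE; apply: differentiableM.
rewrite mxE big_split_ord /= big_ord1 (bigD1 j)//= big1 ?addr0 => [|k kj].
  rewrite [X in X * _]mxE lE [X in _ * X + _]mxE row_mxEl.
  rewrite [X in _ + X * _]mxE rE [X in _ + _ * X]mxE row_mxEr.
  rewrite !mxE eqxx mulr1.
  rewrite /partial (deriveM (diff_derivable du) (diff_derivable (d2fx j))).
  rewrite (deriveN (diff_derivable du)) mulNr.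
  rewrite -[(normal_norm f x)^-1]/(u x); move: (u x) => ux.
  move: ('D__ ('D__ f) x) ('D__ u x) => a c.
  rewrite -[LHS]/(ux * a + partial j f x * c - c * partial j f x).
  by rewrite [c * _]mulrC addrK mulrC.
by rewrite [X in _ * X]mxE row_mxEl [X in _ * X]mxE eq_sym (negPf kj) mulr0.
Qed.

Lemma first_form_det f x : differentiable f x ->
  \det (first_form f x) = normal_norm f x ^+ 2.
Proof.
move=> df; rewrite first_formE//; set u := grad f x.
have <- : \det (block_mx 1%:M (- u^T) u 1%:M) = \det (1%:M + u^T *m u).
  have := det_mulmx (block_mx 1%:M (- u^T) u 1%:M) (block_mx 1%:M 0 (- u) 1%:M).
  rewrite mulmx_block det_lblock !det1 !mulr1 !mulmx1 !mul1mx !mulmx0.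
  by rewrite mulNmx mulmxN opprK subrr !add0r det_ublock det1 mulr1 => ->.
have := det_mulmx (block_mx 1%:M 0 (- u) 1%:M) (block_mx 1%:M (- u^T) u 1%:M).
rewrite mulmx_block det_lblock !det1 !mul1r !mul1mx !mul0mx !mulmx1 !addr0.
rewrite addNr det_ublock det1 mul1r mulNmx mulmxN opprK det_mx11 => <-.
rewrite sqr_sqrtr; last by rewrite addr_ge0// sumr_ge0// => i _; exact: sqr_ge0.
rewrite mxE addrC mxE eqxx; congr (_ + _); rewrite mxE; apply: eq_bigr => i _.
by rewrite !mxE expr2.
Qed.

Lemma gauss_kroneckerE f x : production_function f -> orthant x ->
  gauss_kronecker f x =
  \det (\matrix_(i, j) partial i (partial j f) x) / normal_norm f x ^+ n.+2.
Proof.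
move=> pf ox; have [_ /(_ _ ox) df _] := pf.
have dg : \det (invmx (first_form f x)) = normal_norm f x ^- 2.
  by rewrite det_inv (first_form_det df).
have db : \det (second_form f x) =
    normal_norm f x ^- n * \det (\matrix_(i, j) partial i (partial j f) x).
  rewrite -exprVn -detZ; congr (\det _); apply/matrixP => i j.
  by rewrite second_formE// mulrC [RHS]mxE; congr (_ * _); rewrite mxE.
apply: (etrans (det_mulmx _ _)); apply: (etrans (congr2 *%R db dg)).
have -> : normal_norm f x ^+ n.+2 =
    normal_norm f x ^+ n * normal_norm f x ^+ 2.
  by rewrite -exprD addn2.
move: (_ ^+ n) (_ ^+ 2) (\det _) => a b c.
by rewrite invfM mulrA (mulrC c).
Qed.

Let sectional_quotient (w a b p q r : R) :
  (p / w * (q / w) - (r / w) ^+ 2) /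
    ((1%:R + a * a) * (1%:R + b * b) - (0%:R + a * b) ^+ 2) =
  (p * q - r ^+ 2) / (w ^+ 2 * (1 + a ^+ 2 + b ^+ 2)).
Proof.
rewrite expr_div_n !mulf_div -expr2 -mulrBl -mulrA -invfM.
by congr (_ / (_ * _)); ring.
Qed.

Lemma sectional_curvatureE f i j x : production_function f -> orthant x ->
  i != j ->
  sectional_curvature i j f x =
  (partial i (partial i f) x * partial j (partial j f) x
    - partial i (partial j f) x ^+ 2) /
  (normal_norm f x ^+ 2 * (1 + partial i f x ^+ 2 + partial j f x ^+ 2)).
Proof.
move=> pf ox ij; have [_ /(_ _ ox) df _] := pf.
have gE k l : first_form f x k l = (k == l)%:R + partial k f x * partial l f x.
  rewrite first_formE// mxE [X in X + _]mxE [X in _ + X]mxE big_ord1.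
  by rewrite [X in X * _]mxE [X in X * _]mxE [X in _ * X]mxE.
have bE k l := second_formE k l pf ox; move: gE bE.
rewrite /sectional_curvature.
move: (first_form f x) (second_form f x) => g b gE bE.
rewrite !gE !bE !eqxx (negPf ij).
exact: sectional_quotient.
Qed.
End production.

Arguments orthant {R n}.

(* Main.v *)
Require Import Defs.
From mathcomp Require Import all_boot all_order all_algebra.
From mathcomp Require Import all_classical all_reals all_analysis.
From mathcomp Require Import ring lra.

Import Order.TTheory GRing.Theory Num.Theory.
Import numFieldNormedType.Exports.

Local Open Scope ring_scope.

(** Write [U x] for the inner sum [\sum_i h_i (x_i)], so that [f x = G (U x)]
and [f_i = G' (U x) * h_i' (x_i)].  The summands are not assumed to be
differentiable, but since [G' > 0] the function [G] has a differentiable local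
inverse, and [U] is that inverse applied to [f] ([is_derive_summand]).

The orthant becomes the whole space under the coordinatewise logarithm, so a
function whose partial derivatives vanish there is constant, and a function
whose [i]-th partial derivative depends on [x_i] alone is a sum of functions of
one variable ([constant_orthant], [separable_of_partial]).  This integration
principle yields the functional forms for constant elasticities and for
proportional rates of substitution.

Constant elasticity [k] in [x_i] says [(ln f)_i = k / x_i].  Then
[ln f - k * ln x_i] does not depend on [x_i], hence neither does its derivative
[(G' / f) h_j'] in another variable [x_j], while [G' / f = k / (x_i h_i')]
depends on [x_i] alone; so [G' / f] is a constant [D] ([log_slope_const]) and
[ln f] has the partial derivatives of [k * ln x_i + D * \sum_(j != i) h_j].
When all the elasticities are constant, [ln f] is integrated directly.

Proportional marginal rates of substitution say that [t * h_i' t] is one nonzero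
constant [c] for all [i] and [t] ([proportional_MRSP]), so [U] is an affine
function of [s := \sum_i ln x_i] and [f x = Phi s] for a function [Phi] of one
variable with [p := Phi' != 0] and [q := Phi''] ([log_sum_profile]).  In terms
of this profile [f_ij = (q - delta_ij * p) / (x_i * x_j)], and each curvature
condition becomes a relation between [p] and [q]: the Hessian is singular
exactly when [q = p / n] ([profile_gauss_kroneckerP]), and the sectional
curvatures vanish exactly when [q = p / 2] ([profile_sectional_curvatureP]).
An equation [Phi'' = r * Phi'] integrates to [Phi s = A * exp (r * s) + c], where
[f > 0] forces [A > 0] ([profile_powerP]).  Minimality reads
[(q - p) * \sum_i x_i^-2 = p^3 * ((\sum_i x_i^-2)^2 - \sum_i x_i^-4)];
it fails already at two suitable points with the same value of [s]
([profile_not_minimal]). *)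

Set Implicit Arguments.
Unset Strict Implicit.
Unset Printing Implicit Defensive.

(** * Calculus on the positive orthant *)

Section calculus.
Local Open Scope classical_set_scope.
Local Open Scope ring_scope.
Context {R : realType} {n : nat}.
Implicit Types (F : 'rV[R]_n -> R) (x y v : 'rV[R]_n) (i : 'I_n) (a b t : R).

Lemma orthant_near x : orthant x -> \forall y \near x, orthant y.
Proof.
move=> ox; apply: (@filter_forall _ _ (fun i y => 0 < y 0 i) (nbhs x)) => i.
by apply: (cvgr_gt (x 0 i)); [exact: coord_continuous|exact: ox].
Qed.

(** Reduces directional derivatives to derivatives in one variable, for which
the chain rule of the reals is available. *)
Lemma is_derive_lineP F x v a :
  is_derive x v F a <-> is_derive (0 : R) 1 (fun t : R => F (t *: v + x)) a.
Proof.
have E : 'D_v F x = 'D_1 (fun t : R => F (t *: v + x)) 0.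
  rewrite /derive; set g1 := fun h => h^-1 *: _; set g2 := fun h => h^-1 *: _.
  suff -> : g1 = g2 by [].
  by apply/funext => h; rewrite /g1 /g2/= addr0 scale0r add0r [_%:A]mulr1.
split=> -[dF dE]; split.
- exact: (iffLR (derivable1P F x v) dF).
- exact: etrans (esym E) dE.
- exact: (iffRL (derivable1P F x v) dF).
- exact: etrans E dE.
Qed.

Lemma is_derive_outer F (Phi : R -> R) x v a b :
  is_derive (F x) 1 Phi a -> is_derive x v F b ->
  is_derive x v (Phi \o F) (a * b).
Proof.
move=> dPhi /is_derive_lineP dF; apply/is_derive_lineP.
by apply: is_derive1_comp; rewrite scale0r add0r.
Qed.

Lemma is_derive_orthant F1 F2 x v a : orthant x ->
  (forall y, orthant y -> F1 y = F2 y) ->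
  is_derive x v F1 a -> is_derive x v F2 a.
Proof.
move=> ox eF; apply: near_eq_is_derive.
by near do apply: eF; exact: orthant_near.
Unshelve. all: by end_near. Qed.

Lemma partialP F i x : differentiable F x ->
  is_derive x (delta_mx 0 i) F (partial i F x).
Proof. by move=> dF; apply: derivableP; exact: diff_derivable. Qed.

Lemma is_derive_sum_coordP (phi : 'I_n -> R -> R) i x a :
  is_derive x (delta_mx 0 i) (fun y => \sum_(l < n) phi l (y 0 l)) a <->
  is_derive (x 0 i) 1 (phi i) a.
Proof.
rewrite is_derive_lineP.
have -> : (fun t : R => \sum_(l < n) phi l ((t *: delta_mx 0 i + x) 0 l)) =
    (phi i \o shift (x 0 i)) + cst (\sum_(l < n | l != i) phi l (x 0 l)).
  apply/funext => t; rewrite (bigD1 i)//= !mxE !eqxx mulr1; congr (_ + _).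
  by apply: eq_bigr => l li; rewrite !mxE (negPf li) andbF mulr0 add0r.
split=> dphi.
- have -> : phi i = (phi i \o shift (x 0 i) +
      cst (\sum_(l < n | l != i) phi l (x 0 l)) -
      cst (\sum_(l < n | l != i) phi l (x 0 l))) \o shift (- x 0 i).
    by apply/funext => t /=; rewrite !fctE/= subrK addrK.
  rewrite -[a]mulr1; apply: is_derive1_comp; last exact: is_derive_shift.
  rewrite /= subrr -[a]subr0; exact: is_deriveB.
rewrite -[a]addr0; apply: is_deriveD.
rewrite -[a]mulr1; apply: is_derive1_comp; last exact: is_derive_shift.
by rewrite /= add0r.
Qed.

Lemma differentiable_sum_coord (phi : 'I_n -> R -> R) x :
  (forall l, derivable (phi l) (x 0 l) 1) ->
  differentiable (fun y => \sum_(l < n) phi l (y 0 l)) x.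
Proof.
move=> dphi.
have -> : (fun y => \sum_(l < n) phi l (y 0 l)) =
    \sum_(l < n) (fun y : 'rV[R]_n => phi l (y 0 l)).
  by apply/funext => y; rewrite fct_sumE.
apply: differentiable_sum => l.
apply: (@differentiable_comp _ _ _ _ (fun y : 'rV[R]_n => y 0 l) (phi l)).
  exact: differentiable_coord.
exact/derivable1_diffP.
Qed.

(** Two points [x] and [y] are joined inside the orthant by the curve
[t |-> x^(1 - t) * y^t] (coordinatewise), which is defined for all real [t];
along it [F] has derivative zero. *)
Lemma constant_orthant F x y :
  (forall z, orthant z -> differentiable F z) ->
  (forall i z, orthant z -> partial i F z = 0) ->
  orthant x -> orthant y -> F x = F y.
Proof.
move=> dF pF0 ox oy.
pose c t : 'rV[R]_n :=
  \row_l expR (ln (x 0 l) + t * (ln (y 0 l) - ln (x 0 l))).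
have oc t : orthant (c t) by move=> l; rewrite mxE expR_gt0.
have -> : x = c 0 by apply/rowP => l; rewrite mxE mul0r addr0 lnK ?posrE.
have -> : y = c 1.
  by apply/rowP => l; rewrite mxE mul1r addrC subrK lnK ?posrE.
apply: (@is_derive_0_is_cst _ (F \o c)) => t.
have dc : differentiable c t.
  apply/derivable1_diffP/derivable_mxP => k l.
  rewrite (_ : (fun _ => _) = expR \o
      (cst (ln (x 0 l)) + id * cst (ln (y 0 l) - ln (x 0 l)))).
    by apply: ex_derive.
  by apply/funext => s; rewrite mxE.
have dFc := dF _ (oc t).
have -> : 0 = 'D_1 (F \o c) t.
  rewrite deriveE; last exact: differentiable_comp.
  rewrite diff_comp//= [X in _ = 'd F _ X]row_sum_delta linear_sum big1// => l _.
  by rewrite linearZ/= -(deriveE _ dFc) [X in _ *: X](pF0 _ _ (oc t)) scaler0.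
by apply/derivableP/derivable1_diffP; exact: differentiable_comp.
Qed.

(** [F] minus the sum of the [phi_i] has zero gradient. *)
Lemma separable_of_partial F (phi : 'I_n -> R -> R) (dphi : 'I_n -> R -> R) :
  (forall x, orthant x -> differentiable F x) ->
  (forall i t, 0 < t -> is_derive t 1 (phi i) (dphi i t)) ->
  (forall i x, orthant x -> partial i F x = dphi i (x 0 i)) ->
  exists c, forall x, orthant x -> F x = c + \sum_(i < n) phi i (x 0 i).
Proof.
move=> dF dphiP pF; pose S x := \sum_(i < n) phi i (x 0 i).
have o1 : orthant (const_mx 1 : 'rV[R]_n) by move=> i; rewrite mxE.
have dS x : orthant x -> differentiable S x.
  by move=> ox; apply: differentiable_sum_coord => l; have [] := dphiP l _ (ox l).
exists ((F - S) (const_mx 1)) => x ox.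
rewrite -(@constant_orthant (F - S) x)//; first by rewrite fctE subrK.
  by move=> z oz; apply: differentiableB; [exact: dF|exact: dS].
move=> i z oz; rewrite /partial deriveB; last 2 first.
- exact/diff_derivable/dF.
- exact/diff_derivable/dS.
rewrite -/(partial i F z) pF//.
have /is_derive_sum_coordP dSi := dphiP i _ (oz i).
by rewrite (derive_val (is_derive := dSi)) subrr.
Qed.

Lemma is_derive_expRM (w t : R) :
  is_derive t 1 (fun s => expR (w * s)) (w * expR (w * t)).
Proof.
have := is_derive1_comp (is_derive_expR (w * t))
  (is_deriveZ w (is_derive_id t 1)).
by rewrite mulrC [_ *: _]mulr1.
Qed.

Lemma constant_pos (g : R -> R) (s t : R) :
  (forall u : R, 0 < u -> is_derive u 1 g 0) -> 0 < s -> 0 < t -> g s = g t.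
Proof.
move=> dg s0 t0; rewrite -[s]lnK ?posrE// -[t in RHS]lnK ?posrE//.
apply: (@is_derive_0_is_cst _ (g \o expR)) => u.
have := is_derive1_comp (dg _ (expR_gt0 u)) (is_derive_expR u).
by rewrite mul0r.
Qed.

End calculus.

(** * Elasticity and exponentials of separable functions *)

Section elasticity.
Context {R : realType} {n : nat}.
Implicit Types (f : 'rV[R]_n -> R) (x : 'rV[R]_n) (i j : 'I_n) (s t : R).

Lemma is_derive_ln_comp f i x : production_function f -> orthant x ->
  is_derive x (delta_mx 0 i) (@ln R \o f) ((f x)^-1 * partial i f x).
Proof.
move=> [f0 df _] ox; apply: is_derive_outer; last exact: partialP (df _ ox).
exact/is_derive1_ln/f0.
Qed.

Lemma differentiable_ln_comp f x : production_function f -> orthant x ->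
  differentiable (@ln R \o f) x.
Proof.
move=> [f0 df _] ox; apply: differentiable_comp; first exact: df.
by apply/derivable1_diffP; have [] := is_derive1_ln (f0 _ ox).
Qed.

(** The elasticity is [x_i] times the [i]-th partial derivative of [ln f]. *)
Lemma elasticity_exp_separable f (phi : 'I_n -> R -> R) (c a : R) i x :
  (forall y, orthant y -> f y = expR (c + \sum_(l < n) phi l (y 0 l))) ->
  orthant x -> is_derive (x 0 i) 1 (phi i) a -> elasticity i f x = x 0 i * a.
Proof.
move=> fE ox /is_derive_sum_coordP dphi.
have dexp (s : R) : is_derive s 1 (expR \o (fun t => c + t)) (expR (c + s)).
  have dc : is_derive s 1 (fun t => c + t) 1.
    by have := is_deriveD (is_derive_cst c s 1) (is_derive_id s 1); rewrite add0r.
  by have := is_derive1_comp (is_derive_expR (c + s)) dc; rewrite mulr1.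
have /(is_derive_orthant ox) df := is_derive_outer (dexp _) dphi.
have /df {}df : forall y, orthant y ->
    ((expR \o (fun t => c + t)) \o (fun y => \sum_(l < n) phi l (y 0 l))) y = f y.
  by move=> y oy; rewrite fE.
rewrite /elasticity [partial i f x](derive_val (is_derive := df)) fE//.
by rewrite mulrA divfK// gt_eqF// expR_gt0.
Qed.

Lemma exp_separable_of_elasticity f (phi dphi : 'I_n -> R -> R) :
  production_function f ->
  (forall i t, 0 < t -> is_derive t 1 (phi i) (dphi i t)) ->
  (forall i x, orthant x -> elasticity i f x = x 0 i * dphi i (x 0 i)) ->
  exists c, forall x, orthant x -> f x = expR (c + \sum_(i < n) phi i (x 0 i)).
Proof.
move=> pf phiP fe; have [f0 _ _] := pf.
have [|i x ox|c cE] := @separable_of_partial _ _ (@ln R \o f) _ _ _ phiP.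
- by move=> x; exact: differentiable_ln_comp.
- rewrite /partial (derive_val (is_derive := is_derive_ln_comp i pf ox)).
  apply: (mulfI (lt0r_neq0 (ox i))); rewrite -fe// /elasticity.
  by rewrite mulrA.
by exists c => x ox; rewrite -cE//= lnK// posrE f0.
Qed.

Lemma prod_powRE (alpha : 'I_n -> R) x : orthant x ->
  \prod_(i < n) (x 0 i `^ alpha i) = expR (\sum_(i < n) alpha i * ln (x 0 i)).
Proof.
move=> ox; rewrite expR_sum; apply: eq_bigr => i _.
by rewrite /powR gt_eqF//; exact: ox.
Qed.

(** [ln f] has the partial derivatives [alpha_i / x_i]; integrate. *)
Lemma cobb_douglas_elasticityP f (alpha : 'I_n -> R) : production_function f ->
  (forall i, constant_elasticity i f (alpha i)) <->
  (exists2 A : R, 0 < A & forall x, orthant x ->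
     f x = A * \prod_(i < n) (x 0 i `^ alpha i)).
Proof.
move=> pf.
have dln i (t : R) : 0 < t ->
    is_derive t 1 (fun t => alpha i * ln t) (alpha i / t).
  by move=> t0; apply: is_deriveZ; exact: is_derive1_ln.
split=> [fe|[A A0 fE] i x ox].
  have [|c cE] := @exp_separable_of_elasticity _ _ _ pf dln.
    by move=> i x ox; rewrite fe// mulrC divfK// gt_eqF//; exact: ox.
  exists (expR c); first exact: expR_gt0.
  by move=> x ox; rewrite prod_powRE// -expRD cE.
have fexp y : orthant y -> f y = expR (ln A + \sum_(l < n) alpha l * ln (y 0 l)).
  by move=> oy; rewrite fE// prod_powRE// expRD lnK.
rewrite (elasticity_exp_separable (phi := fun l t => alpha l * ln t) fexp ox
  (dln _ _ (ox i))).
by rewrite mulrC divfK// gt_eqF//; exact: ox.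
Qed.

End elasticity.

(** * Test points of the orthant *)

Section points.
Context {R : realType} {n : nat}.
Implicit Types (i j : 'I_n) (a b s : R).

Definition log_diag s : 'rV[R]_n := const_mx (expR (s / n%:R)).

Lemma log_diag_orthant s : orthant (log_diag s).
Proof. by move=> i; rewrite mxE expR_gt0. Qed.

Lemma sum_ln_log_diag s : (0 < n)%N -> \sum_(i < n) ln (log_diag s 0 i) = s.
Proof.
move=> n0; under eq_bigr do rewrite mxE expRK.
by rewrite sumr_const card_ord -[LHS]mulr_natr divfK// pnatr_eq0 -lt0n.
Qed.

Definition two_coord i j a b : 'rV[R]_n :=
  \row_l (if l == i then a else if l == j then b else 1).

Lemma two_coord_orthant i j a b : 0 < a -> 0 < b -> orthant (two_coord i j a b).
Proof. by move=> a0 b0 l; rewrite mxE; do 2?case: ifP. Qed.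

Lemma two_coordl i j a b : two_coord i j a b 0 i = a.
Proof. by rewrite mxE eqxx. Qed.

Lemma two_coordr i j a b : i != j -> two_coord i j a b 0 j = b.
Proof. by move=> ij; rewrite mxE eq_sym (negPf ij) eqxx. Qed.

Lemma sum_two_coord (phi : 'I_n -> R -> R) i j a b : i != j ->
  \sum_(l < n) phi l (two_coord i j a b 0 l) =
  phi i a + phi j b + \sum_(l < n | (l != i) && (l != j)) phi l 1.
Proof.
move=> ij; rewrite (bigD1 i)//= two_coordl (bigD1 j) 1?eq_sym//= two_coordr//.
rewrite addrA; congr (_ + _); apply: eq_bigr => l /andP[li lj].
by rewrite mxE (negPf li) (negPf lj).
Qed.

Lemma exists_other i : (2 <= n)%N -> exists j, i != j.
Proof.
move=> n2; have [i0|] := eqVneq i (Ordinal (ltnW n2)).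
  by exists (Ordinal n2); rewrite i0.
by exists (Ordinal (ltnW n2)).
Qed.

End points.

Arguments log_diag {R} n.

(** * Quasi-sum production functions *)

Section quasi_sum.
Local Open Scope classical_set_scope.
Local Open Scope ring_scope.
Context {R : realType} {n : nat}.
Variables (f : 'rV[R]_n -> R) (G : R -> R) (h : 'I_n -> R -> R) (J : set R).
Hypotheses (pf : production_function f) (oJ : open J) (iJ : is_interval J).
Hypothesis dG : forall u, J u -> derivable G u 1 /\ 0 < 'D_1 G u.
Hypothesis mh : forall i, strictly_monotone [set t | 0 < t] (h i).

Implicit Types (x : 'rV[R]_n) (i j : 'I_n) (u v t : R).

Let U (x : 'rV[R]_n) := \sum_(i < n) h i (x 0 i).

Hypothesis JU : forall x, orthant x -> J (U x).
Hypothesis fE : forall x, orthant x -> f x = G (U x).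

(** [J] is an interval, so the positive derivative makes [G] increasing on it. *)
Lemma quasi_sum_incr u v : J u -> J v -> u < v -> G u < G v.
Proof.
move=> Ju Jv uv.
have sJ t : u <= t -> t <= v -> J t.
  by move=> ut tv; apply: (iJ Ju Jv); rewrite ut tv.
have dsJ t : t \in `[u, v] -> derivable G t 1.
  by rewrite in_itv/= => /andP[ut tv]; have [] := dG (sJ _ ut tv).
apply: (@gtr0_derive1_incr _ G u v) => //.
- by move=> t tuv; apply: dsJ; exact: subset_itv_oo_cc tuv.
- move=> t; rewrite in_itv/= => /andP[ut tv].
  by rewrite derive1E; have [] := dG (sJ _ (ltW ut) (ltW tv)).
- exact: derivable_within_continuous.
Qed.

Lemma quasi_sum_inj u v : J u -> J v -> G u = G v -> u = v.
Proof.
move=> Ju Jv Guv; case: (ltgtP u v) => // uv.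
  by have := quasi_sum_incr Ju Jv uv; rewrite Guv ltxx.
by have := quasi_sum_incr Jv Ju uv; rewrite Guv ltxx.
Qed.

(** [U] is the local inverse of [G] applied to [f], and along the direction of
[x_i] it differs from [h_i] by a constant. *)
Lemma is_derive_summand i x : orthant x ->
  is_derive (x 0 i) 1 (h i) (('D_1 G (U x))^-1 * partial i f x).
Proof.
move=> ox; have [_ df _] := pf.
pose g y := xget 0 [set u | J u /\ G u = y].
have GK u : J u -> g (G u) = u.
  move=> Ju; rewrite /g; case: xgetP => [v -> [Jv]|/(_ u)[]//].
  exact: quasi_sum_inj.
have Jnear : \forall u \near U x, J u by exact/open_nbhs_nbhs/(conj oJ)/JU.
have dg : is_derive (f x) 1 g ('D_1 G (U x))^-1.
  rewrite fE//; apply: is_derive_inverse.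
  - by near do apply: GK.
  - near=> u; apply/differentiable_continuous/derivable1_diffP.
    by have [] : derivable G u 1 /\ 0 < 'D_1 G u by apply: dG; near: u.
  - by apply: derivableP; have [] := dG (JU ox).
  - by rewrite gt_eqF//; have [] := dG (JU ox).
apply/is_derive_sum_coordP.
apply: (@is_derive_orthant _ _ (g \o f)) => //.
  by move=> y oy /=; rewrite fE// GK//; exact: JU.
apply: is_derive_outer => //.
exact: partialP (df _ ox).
Unshelve. all: by end_near. Qed.

Lemma derivable_summand i t : 0 < t -> derivable (h i) t 1.
Proof.
move=> t0; have ot : orthant (const_mx t : 'rV[R]_n) by move=> l; rewrite mxE.
by have [] := is_derive_summand i ot; rewrite mxE.
Qed.

Lemma quasi_sum_partial i x : orthant x ->
  partial i f x = 'D_1 G (U x) * 'D_1 (h i) (x 0 i).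
Proof.
move=> ox; rewrite (derive_val (is_derive := is_derive_summand i ox)).
by rewrite mulVKf// gt_eqF//; have [] := dG (JU ox).
Qed.

(** A strictly monotone function may have critical points, but its derivative
does not vanish identically. *)
Lemma summand_derive_neq0 i : exists2 t, 0 < t & 'D_1 (h i) t != 0.
Proof.
apply: contrapT => /forall2NP hz.
have h12 : h i 1 = h i 2.
  apply: constant_pos => // t t0; split; first exact: derivable_summand.
  by apply: contrapT => /eqP; case: (hz t).
have l12 : 1 < 2 :> R by rewrite ltr1n.
by case: (mh i) => /(_ 1 2 ltr01 (ltr0Sn _ 1) l12); rewrite h12 ltxx.
Qed.

Lemma quasi_sum_elasticity i x : orthant x ->
  elasticity i f x = x 0 i * ('D_1 G (U x) / f x * 'D_1 (h i) (x 0 i)).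
Proof.
move=> ox; rewrite /elasticity quasi_sum_partial// -mulrA; congr (_ * _).
by rewrite mulrCA mulrA.
Qed.

Lemma log_slope_gt0 x : orthant x -> 0 < 'D_1 G (U x) / f x.
Proof.
by move=> ox; have [f0 _ _] := pf; rewrite divr_gt0 ?f0//; have [] := dG (JU ox).
Qed.

Lemma constant_elasticity_neq0 i k : constant_elasticity i f k -> k != 0.
Proof.
move=> fe; have [t t0 ht] := summand_derive_neq0 i.
have ot : orthant (const_mx t : 'rV[R]_n) by move=> l; rewrite mxE.
rewrite -(fe _ ot) quasi_sum_elasticity//.
apply: mulf_neq0; first by rewrite gt_eqF//; exact: ot.
by apply: mulf_neq0; [rewrite gt_eqF// log_slope_gt0|rewrite mxE].
Qed.

(** The mixed-derivative argument.  [M t y] is [ln f] with [x_i = t], [x_j = y]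
and the remaining coordinates fixed.  Its derivative in [t] is [k / t], so
[M t y = M 1 y + k * ln t], and its derivative [r * h_j' y] in [y], where
[r = G' / f], does not depend on [t].  At a point [y = b] with [h_j' b != 0]
this makes [r] independent of [t]; but [r = k / (t * h_i' t)] is a function of
[t] alone, so it is constant. *)
Lemma log_slope_const i j k : i != j -> constant_elasticity i f k ->
  exists2 D, 0 < D & forall x, orthant x -> 'D_1 G (U x) / f x = D.
Proof.
move=> ij fe; have k0 := constant_elasticity_neq0 fe.
have [b b0 hb] := summand_derive_neq0 j.
pose r x := 'D_1 G (U x) / f x.
have rE x : orthant x -> x 0 i * (r x * 'D_1 (h i) (x 0 i)) = k.
  by move=> ox; rewrite -(fe _ ox) quasi_sum_elasticity.
pose p t y := two_coord i j t y : 'rV[R]_n.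
have op (t y : R) : 0 < t -> 0 < y -> orthant (p t y).
  by move=> t0 y0; exact: two_coord_orthant.
pose rest := \sum_(l < n | (l != i) && (l != j)) h l 1.
pose M (t y : R) := ln (G (h i t + h j y + rest)).
have Up t y : U (p t y) = h i t + h j y + rest.
  by rewrite /U sum_two_coord.
have dlnG (t y : R) : 0 < t -> 0 < y ->
    is_derive (U (p t y)) 1 (@ln R \o G) (r (p t y)).
  move=> t0 y0; have [f0 _ _] := pf; have o := op _ _ t0 y0.
  rewrite /r mulrC fE//; apply: is_derive1_comp.
    by apply: is_derive1_ln; rewrite -fE// f0.
  by apply: derivableP; have [] := dG (JU o).
have dM1 (t y : R) : 0 < t -> 0 < y -> is_derive t 1 (M^~ y) (k / t).
  move=> t0 y0; have o := op _ _ t0 y0.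
  have <- : r (p t y) * 'D_1 (h i) t = k / t.
    by rewrite -(rE _ o) two_coordl [RHS]mulrC mulKf// gt_eqF.
  apply: (@is_derive1_comp _ (@ln R \o G) (fun t => h i t + h j y + rest));
    first by rewrite -Up; exact: dlnG.
  have /derivableP dhi : derivable (h i) t 1 by exact: derivable_summand.
  by have := is_deriveD (is_deriveD dhi (is_derive_cst (h j y) t 1))
    (is_derive_cst rest t 1); rewrite !addr0.
have dM2 (t y : R) : 0 < t -> 0 < y ->
    is_derive y 1 (M t) (r (p t y) * 'D_1 (h j) y).
  move=> t0 y0; have o := op _ _ t0 y0.
  apply: (@is_derive1_comp _ (@ln R \o G) (fun y => h i t + h j y + rest));
    first by rewrite -Up; exact: dlnG.
  have /derivableP dhj : derivable (h j) y 1 by exact: derivable_summand.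
  by have := is_deriveD (is_deriveD (is_derive_cst (h i t) y 1) dhj)
    (is_derive_cst rest y 1); rewrite add0r addr0.
have ME (t y : R) : 0 < t -> 0 < y -> M t y = M 1 y + k * ln t.
  move=> t0 y0.
  have : (M^~ y - (fun t => k * ln t)) t = (M^~ y - (fun t => k * ln t)) 1.
    apply: constant_pos => // u u0; rewrite -(subrr (k / u)).
    apply: is_deriveB; first exact: dM1.
    by apply: is_deriveZ; exact: is_derive1_ln.
  by rewrite !fctE ln1 mulr0 subr0 => <-; rewrite subrK.
have rconst (t : R) : 0 < t -> r (p t b) = r (p 1 b).
  move=> t0; apply: (mulIf hb).
  have dMt : is_derive b 1 (M t) (r (p 1 b) * 'D_1 (h j) b).
    have := is_deriveD (dM2 _ _ ltr01 b0) (is_derive_cst (k * ln t) b 1).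
    rewrite addr0; apply: near_eq_is_derive.
    by near=> y; rewrite [RHS]ME//; near: y; exact: lt_nbhsr.
  rewrite -(derive_val (is_derive := dM2 _ _ t0 b0)).
  by rewrite -(derive_val (is_derive := dMt)).
exists (r (p 1 b)); first exact/log_slope_gt0/op.
move=> x ox; have x0 := ox i.
have hx : 'D_1 (h i) (x 0 i) != 0.
  by apply: contraNneq k0 => h0; rewrite -(rE _ ox) h0 !mulr0.
apply/(mulIf hx)/(mulfI (lt0r_neq0 x0)); rewrite [LHS](rE _ ox).
by have := rE _ (op _ _ x0 b0); rewrite two_coordl rconst.
Unshelve. all: by end_near. Qed.

Lemma power_times_expE A D k i x : 0 < A -> orthant x ->
  A * (x 0 i `^ k) * expR (D * \sum_(j < n | j != i) h j (x 0 j)) =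
  expR (ln A +
    \sum_(l < n) (if l == i then k * ln (x 0 l) else D * h l (x 0 l))).
Proof.
move=> A0 ox; rewrite [in RHS](bigD1 i)//= eqxx addrA !expRD lnK//.
rewrite {1}/powR gt_eqF; last exact: ox.
by congr (_ * expR _); rewrite mulr_sumr; apply: eq_bigr => l /negPf ->.
Qed.

Lemma constant_elasticityP i k : (2 <= n)%N ->
  constant_elasticity i f k <->
  exists A D : R, 0 < A /\ 0 < D /\
    forall x, orthant x ->
      f x = A * (x 0 i `^ k) * expR (D * \sum_(j < n | j != i) h j (x 0 j)).
Proof.
move=> n2; split=> [fe|[A [D [A0 [D0 fx]]]] x ox].
  have [j ij] := exists_other i n2.
  have [D D0 DE] := log_slope_const ij fe.
  pose phi l t := if l == i then k * ln t else D * h l t.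
  pose dphi l t := if l == i then k / t else D * 'D_1 (h l) t.
  have [l t t0|l x ox|c cE] := @exp_separable_of_elasticity _ _ f phi dphi pf.
  - rewrite /phi /dphi; case: eqP => _; apply: is_deriveZ.
      exact: is_derive1_ln.
    by apply: derivableP; exact: derivable_summand.
  - (* [x_i * (k / x_i)] is the elasticity in [x_i]; for the other factors the
    constant log-slope [D] gives [(ln f)_l = D * h_l'] *)
    rewrite /dphi; case: eqP => [->|_]; last by rewrite quasi_sum_elasticity// DE.
    by rewrite fe// mulrC divfK// gt_eqF//; exact: ox.
  exists (expR c), D; split; first exact: expR_gt0.
  by split=> // x ox; rewrite power_times_expE ?expR_gt0// expRK cE.
pose phi l t := if l == i then k * ln t else D * h l t.
have fphi y : orthant y -> f y = expR (ln A + \sum_(l < n) phi l (y 0 l)).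
  by move=> oy; rewrite fx// power_times_expE.
have dphi : is_derive (x 0 i) 1 (phi i) (k / x 0 i).
  by rewrite /phi eqxx; apply: is_deriveZ; apply: is_derive1_ln; exact: ox.
rewrite (elasticity_exp_separable fphi ox dphi).
by rewrite mulrC divfK// gt_eqF//; exact: ox.
Qed.

(** As there are at least two factors, [t * h_i' t] can be compared with the
value of another summand at a fixed point, so it is constant in [t] as well as
in [i].  The constant is nonzero because no [h_i'] vanishes identically. *)
Lemma equal_log_derivatives : (2 <= n)%N ->
  (forall i j a b, i != j -> 0 < a -> 0 < b ->
     a * 'D_1 (h i) a = b * 'D_1 (h j) b) ->
  exists2 c, c != 0 & forall i t, 0 < t -> 'D_1 (h i) t = c / t.
Proof.
move=> n2 eqh; pose i0 := Ordinal n2.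
have [t t0 ht] := summand_derive_neq0 i0.
have cE i s : 0 < s -> s * 'D_1 (h i) s = t * 'D_1 (h i0) t.
  move=> s0; have [->|ii0] := eqVneq i i0; last exact: eqh.
  have [j i0j] := exists_other i0 n2.
  by rewrite (eqh _ j s 1)// (eqh _ j t 1).
exists (t * 'D_1 (h i0) t); first by rewrite mulf_neq0// gt_eqF.
by move=> i s s0; rewrite -(cE i s s0) mulrC mulKf// gt_eqF.
Qed.

(** The factor [G'] cancels in the marginal rate of substitution, which is
[h_j' / h_i']. *)
Lemma proportional_MRSP : (2 <= n)%N ->
  proportional_MRS f <->
  exists2 c, c != 0 & forall i t, 0 < t -> 'D_1 (h i) t = c / t.
Proof.
move=> n2; split=> [mrs|[c c0 hc] i j ij x ox].
  apply: equal_log_derivatives => // i j a b ij a0 b0.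
  have ox := two_coord_orthant i j a0 b0.
  have := mrs _ _ ij _ ox; rewrite /MRS !quasi_sum_partial//.
  rewrite two_coordl (two_coordr _ _ ij).
  have g0 : 'D_1 G (U (two_coord i j a b)) != 0.
    by rewrite gt_eqF//; have [] := dG (JU ox).
  rewrite -mulf_div divff// mul1r => e.
  (* [_ / 0] is [0], which is not the positive ratio [a / b] *)
  have hi0 : 'D_1 (h i) a != 0.
    apply: contraPneq e => ->; rewrite invr0 mulr0 => /esym/eqP.
    by rewrite mulf_eq0 invr_eq0 !gt_eqF.
  rewrite -[in RHS](divfK hi0 ('D_1 (h j) b)) e mulrA mulrCA.
  by rewrite divff ?gt_eqF// mulr1.
rewrite /MRS !quasi_sum_partial// !hc; do ?exact: ox.
have g0 : 'D_1 G (U x) != 0 by rewrite gt_eqF//; have [] := dG (JU ox).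
move: (x 0 i) (x 0 j) ('D_1 G _) (ox i) (ox j) g0 => a b g a0 b0 g0.
by field; rewrite g0 c0 !gt_eqF.
Qed.

(** Integrating [h_i' t = c / t] gives an affine function of the sum of the
logarithms.  That sum takes every real value on the orthant, so [G] is defined
and differentiable at [d + c * s] for every real [s]. *)
Lemma log_linear_of_derive c : (0 < n)%N ->
  (forall i t, 0 < t -> 'D_1 (h i) t = c / t) ->
  exists d, (forall x, orthant x -> U x = d + c * \sum_(i < n) ln (x 0 i)) /\
    forall s, J (d + c * s).
Proof.
move=> n0 hc.
have dh i t : 0 < t -> is_derive t 1 (h i) (c / t).
  by move=> t0; rewrite -(hc i)//; apply: derivableP; exact: derivable_summand.
have [||i x ox|d dE] := @separable_of_partial _ _ U (fun=> fun t => c * ln t)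
    (fun=> fun t => c / t).
- move=> x ox; apply: differentiable_sum_coord => i; apply: derivable_summand.
  exact: ox.
- by move=> i t t0; apply: is_deriveZ; exact: is_derive1_ln.
- have /is_derive_sum_coordP dU := dh i _ (ox i).
  by rewrite /partial (derive_val (is_derive := dU)).
have UE x : orthant x -> U x = d + c * \sum_(i < n) ln (x 0 i).
  by move=> ox; rewrite dE// mulr_sumr.
exists d; split=> // s.
have := JU (log_diag_orthant s); rewrite UE; last exact: log_diag_orthant.
by rewrite sum_ln_log_diag.
Qed.

(** The curve multiplying [x_i] by [e^s] and dividing [x_j] by [e^s] stays in a
level set of [U]; differentiate [U] along it at [s = 0]. *)
Lemma equal_log_derivatives_of_sum_ln :
  (forall y z, orthant y -> orthant z ->
    \sum_(l < n) ln (y 0 l) = \sum_(l < n) ln (z 0 l) -> U y = U z) ->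
  forall i j a b, i != j -> 0 < a -> 0 < b ->
    a * 'D_1 (h i) a = b * 'D_1 (h j) b.
Proof.
move=> Uln i j a b ij a0 b0.
pose x s : 'rV[R]_n := two_coord i j (a * expR s) (b * expR (- s)).
have ox s : orthant (x s).
  by apply: two_coord_orthant; rewrite mulr_gt0// expR_gt0.
have lnx s : \sum_(l < n) ln (x s 0 l) =
    ln a + ln b + \sum_(l < n | (l != i) && (l != j)) ln (1 : R).
  rewrite (sum_two_coord (fun=> @ln R) _ _ ij); congr (_ + _).
  by rewrite !lnM ?posrE ?expR_gt0// !expRK addrACA subrr addr0.
have Ux s : U (x s) = U (x 0) by apply: Uln => //; rewrite lnx [RHS]lnx.
pose rest := \sum_(l < n | (l != i) && (l != j)) h l 1.
have dh l (e w : R) : 0 < e -> is_derive (0 : R) 1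
    (fun s => h l (e * expR (w * s))) (w * (e * 'D_1 (h l) e)).
  move=> e0; have -> : w * (e * 'D_1 (h l) e) = 'D_1 (h l) e * (e * w) by ring.
  apply: (@is_derive1_comp _ (h l) (fun s => e * expR (w * s))).
    by rewrite mulr0 expR0 mulr1; apply: derivableP; exact: derivable_summand.
  have := is_deriveZ e (is_derive_expRM w 0).
  by rewrite mulr0 expR0 mulr1.
have dUx := is_deriveD (is_deriveD (dh i a 1 a0) (dh j b (-1) b0))
  (is_derive_cst rest (0 : R) 1).
have Ecst : (fun s => h i (a * expR (1 * s))) +
    (fun s => h j (b * expR (- 1 * s))) + cst rest = cst (U (x 0)).
  apply/funext => s.
  by rewrite -(Ux s) /U sum_two_coord// !fctE mul1r mulN1r.
rewrite Ecst in dUx; have := derive_val (is_derive := dUx).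
by rewrite derive_cst addr0 mul1r mulN1r => /esym/eqP; rewrite subr_eq0 => /eqP.
Qed.

Lemma homotheticP : (2 <= n)%N ->
  proportional_MRS f <->
  exists (k : R) (F : R -> R), k != 0 /\
    (forall u v : R, 0 < u -> u < v -> F u < F v) /\
    forall x, orthant x -> f x = F (\prod_(i < n) (x 0 i `^ k)).
Proof.
move=> n2; rewrite proportional_MRSP//; split=> [[c c0 hc]|].
  have [d [UE Jd]] := log_linear_of_derive (ltnW n2) hc.
  have J_all s : J (d + s) by have := Jd (s / c); rewrite mulrC divfK.
  (* [ln] of the product of the [x_i^c] is [U x - d] *)
  exists c, (fun p => G (d + ln p)); split=> //; split=> [u v u0 uv|x ox].
    apply: quasi_sum_incr (J_all _) (J_all _) _.
    by rewrite ltrD2l ltr_ln ?posrE// (lt_trans u0).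
  by rewrite fE// UE// prod_powRE// expRK mulr_sumr.
move=> [k [F [k0 [Finc fF]]]].
apply/equal_log_derivatives/equal_log_derivatives_of_sum_ln => // y z oy oz yz.
apply: quasi_sum_inj; [exact: JU|exact: JU|].
rewrite -(fE oy) -(fE oz) (fF _ oy) (fF _ oz).
by rewrite !prod_powRE// -!mulr_sumr yz.
Qed.

(** [Phi s = G (d + c * s)].  Its second derivative exists because [f] is twice
differentiable: [Phi' s] is [x_i * f_i] at the diagonal point over [s]. *)
Lemma log_sum_profile : (2 <= n)%N -> proportional_MRS f ->
  exists Phi p q : R -> R,
    [/\ forall x, orthant x -> f x = Phi (\sum_(i < n) ln (x 0 i)),
        forall s : R, is_derive s 1 Phi (p s),
        forall s : R, is_derive s 1 p (q s)
      & forall s : R, p s != 0].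
Proof.
move=> n2 /(proportional_MRSP n2)[c c0 hc]; have [_ _ d2f] := pf.
have [d [UE Jd]] := log_linear_of_derive (ltnW n2) hc.
pose i0 := Ordinal n2.
pose p s := 'D_1 G (d + c * s) * c.
have pE : p = (fun s => expR (n%:R^-1 * s)) * (partial i0 f \o log_diag n).
  apply/funext => s; have o := log_diag_orthant s.
  rewrite !fctE/= quasi_sum_partial// UE// sum_ln_log_diag ?(ltnW n2)//.
  rewrite hc ?mxE ?expR_gt0// [n%:R^-1 * s]mulrC /p.
  by field; rewrite gt_eqF// expR_gt0.
exists (fun s => G (d + c * s)), p, ('D_1 p); split.
- by move=> x ox; rewrite fE// UE.
- move=> s; apply: (@is_derive1_comp _ G (fun s => d + c * s)).
    by apply: derivableP; have [] := dG (Jd s).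
  have := is_deriveD (is_derive_cst d s 1) (is_deriveZ c (is_derive_id s 1)).
  by rewrite add0r [_ *: _]mulr1.
- move=> s; apply: derivableP; rewrite pE; apply: derivableM.
    by have [] := is_derive_expRM n%:R^-1 s.
  apply/derivable1_diffP/differentiable_comp; last first.
    exact/d2f/log_diag_orthant.
  apply/derivable1_diffP/derivable_mxP => k l.
  have -> : (fun s : R => log_diag n s k l) = (fun s => expR (n%:R^-1 * s)).
    by apply/funext => t; rewrite mxE mulrC.
  by have [] := is_derive_expRM n%:R^-1 s.
- by move=> s; rewrite mulf_neq0// gt_eqF//; have [] := dG (Jd s).
Qed.

End quasi_sum.

(** * Functions of the sum of the logarithms *)

Section profile.
Context {R : realType} {n : nat}.
Variables (f : 'rV[R]_n -> R) (Phi p q : R -> R).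
Implicit Types (x : 'rV[R]_n) (i j : 'I_n) (s t : R).

Let S x := \sum_(i < n) ln (x 0 i).

Hypotheses (pf : production_function f) (n0 : (0 < n)%N).
Hypothesis fPhi : forall x, orthant x -> f x = Phi (S x).
Hypothesis dPhi : forall s, is_derive s 1 Phi (p s).
Hypothesis dp : forall s, is_derive s 1 p (q s).
Hypothesis p_neq0 : forall s, p s != 0.

Lemma is_derive_sum_ln i x : orthant x ->
  is_derive x (delta_mx 0 i) S (x 0 i)^-1.
Proof.
move=> ox; apply: (iffRL (is_derive_sum_coordP (fun=> @ln R) i x _)).
exact/is_derive1_ln/ox.
Qed.

Lemma profile_partial i x : orthant x -> partial i f x = p (S x) / x 0 i.
Proof.
move=> ox; have := is_derive_outer (dPhi _) (is_derive_sum_ln i ox).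
move=> /(is_derive_orthant ox) df; apply: derive_val; apply: df.
by move=> y oy; rewrite fPhi.
Qed.

Lemma profile_partial2 i j x : orthant x ->
  partial j (partial i f) x =
  (q (S x) - (i == j)%:R * p (S x)) / (x 0 i * x 0 j).
Proof.
move=> ox; have xi0 := lt0r_neq0 (ox i); have xj0 := lt0r_neq0 (ox j).
have dpS := is_derive_outer (dp _) (is_derive_sum_ln j ox).
have dxi : is_derive x (delta_mx 0 j) (fun y => y 0 i) (i == j)%:R.
  rewrite eq_sym -(partial_coord j i x); apply: partialP.
  exact: differentiable_coord.
have dxiV : is_derive x (delta_mx 0 j) (fun y => (y 0 i)^-1)
    (- (x 0 i) ^- 2 * (i == j)%:R).
  split; first by apply: derivableV => //; have [] := dxi.
  by rewrite deriveV; [have [_ ->] := dxi|exact: xi0|have [] := dxi].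
have /(is_derive_orthant ox) df := is_deriveM dpS dxiV.
rewrite [LHS](derive_val (is_derive := df (partial i f) _)); last first.
  by move=> y oy; rewrite profile_partial.
have [ij|ij] := eqVneq i j; rewrite /GRing.scale/=; last first.
  by rewrite mulr0 mulr0 add0r mul0r subr0; field; rewrite xi0 xj0.
by rewrite -ij mulr1 mul1r; field; rewrite xi0.
Qed.

(** The sum of the logarithms takes every real value on the orthant. *)
Lemma forall_profile (P : R -> Prop) :
  (forall x, orthant x -> P (S x)) <-> (forall s, P s).
Proof.
split=> [PS s|Ps x _]; last exact: Ps.
have := PS (log_diag n s) (log_diag_orthant s).
by rewrite /S sum_ln_log_diag.
Qed.

(** The equation [Phi'' = r * Phi'] says that [Phi' s * e^(- r s)] is constant,
and then that [Phi s - A * e^(r s)] is constant.  As [Phi > 0] on the whole line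
and [e^(r s)] is unbounded, [A] cannot be negative. *)
Lemma profile_powerP r : 0 < r ->
  (forall s, q s = r * p s) <->
  exists A c : R, 0 < A /\
    forall x, orthant x -> f x = A * \prod_(i < n) (x 0 i `^ r) + c.
Proof.
move=> r0; have rn0 := lt0r_neq0 r0.
have prodE x : orthant x -> \prod_(i < n) (x 0 i `^ r) = expR (r * S x).
  by move=> ox; rewrite prod_powRE// mulr_sumr.
have PhiE s : Phi s = f (log_diag n s).
  by rewrite fPhi /S ?sum_ln_log_diag//; exact: log_diag_orthant.
split=> [qE|[A [c [A0 fE]]] s].
  have pE s : p s = p 0 * expR (r * s).
    have : (p * (fun s => expR (- r * s))) s = (p * (fun s => expR (- r * s))) 0.
      apply: is_derive_0_is_cst => t.
      have := is_deriveM (dp t) (is_derive_expRM (- r) t); rewrite qE.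
      by rewrite /GRing.scale/= (_ : _ + _ = 0)//; ring.
    rewrite !fctE/= mulr0 expR0 mulr1 => <-.
    by rewrite mulNr expRN -mulrA mulVf ?mulr1// gt_eqF// expR_gt0.
  pose A := p 0 / r.
  have PhiAc s : Phi s = A * expR (r * s) + (Phi 0 - A).
    have : (Phi - A \*: (fun s => expR (r * s))) s =
           (Phi - A \*: (fun s => expR (r * s))) 0.
      apply: is_derive_0_is_cst => t.
      have := is_deriveB (dPhi t) (is_deriveZ A (is_derive_expRM r t)).
      by rewrite pE /A /GRing.scale/= mulrA divfK// subrr.
    rewrite !fctE/= mulr0 expR0 /GRing.scale/= mulr1 => <-.
    by rewrite [RHS]addrC subrK.
  have A_neq0 : A != 0 by rewrite mulf_neq0// invr_eq0.
  have [f0 _ _] := pf.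
  exists A, (Phi 0 - A); split; last by move=> x ox; rewrite prodE// -PhiAc fPhi.
  rewrite lt_neqAle eq_sym A_neq0 leNgt; apply/negP => A_lt0.
  (* the value of [e^(r s)] for which [A * e^(r s) + (Phi 0 - A)] is at most [A] *)
  pose t := `|Phi 0 - A| / - A + 1.
  have t0 : 0 < t by rewrite ltr_wpDl// divr_ge0// oppr_ge0 ltW.
  have := f0 (log_diag n (ln t / r)) (log_diag_orthant (ln t / r)).
  rewrite -PhiE PhiAc [r * _]mulrC divfK// lnK ?posrE//.
  have -> : A * t = A - `|Phi 0 - A| by rewrite /t; field.
  have := ler_norm (Phi 0 - A); lra.
have PhiAc : Phi = A \*: (fun s => expR (r * s)) + cst c.
  apply/funext => t; rewrite PhiE fE ?prodE/S ?sum_ln_log_diag//;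
    exact: log_diag_orthant.
have pAc : p = (A * r) \*: (fun s => expR (r * s)).
  apply/funext => t; rewrite -(derive_val (is_derive := dPhi t)) PhiAc.
  rewrite (derive_val (is_derive := is_deriveD (is_deriveZ A (is_derive_expRM r t))
    (is_derive_cst c t 1))).
  by rewrite addr0 /GRing.scale/= mulrA.
rewrite -(derive_val (is_derive := dp s)) pAc.
rewrite (derive_val (is_derive := is_deriveZ (A * r) (is_derive_expRM r s))).
exact: mulrCA.
Qed.

(** The Hessian is [D (q J - p I) D] with [D] the diagonal matrix of the [1 / x_i]
and [J] the all-ones matrix.  A row vector [v] is in its kernel when
[p * (v_j / x_j) = q * \sum_i v_i / x_i] for all [j].  If [v] is nonzero then so
is [\sum_i v_i / x_i], and summing over [j] gives [p = n * q]; conversely, if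
[p = n * q] then [v = x] is in the kernel. *)
Lemma profile_gauss_kroneckerP x : orthant x ->
  gauss_kronecker f x = 0 <-> q (S x) = n%:R^-1 * p (S x).
Proof.
move=> ox; have nR0 : n%:R != 0 :> R by rewrite pnatr_eq0 -lt0n.
rewrite gauss_kroneckerE//; set H := \matrix_(i, j) _.
set a := q _; set b := p _; have b0 : b != 0 by exact: p_neq0.
have xn0 i := lt0r_neq0 (ox i).
have vH (v : 'rV[R]_n) j :
    (v *m H) 0 j = (a * (\sum_i v 0 i / x 0 i) - b * (v 0 j / x 0 j)) / x 0 j.
  rewrite mxE mulrBl mulr_sumr mulr_suml.
  rewrite (eq_bigr (fun i => a * (v 0 i / x 0 i) / x 0 j -
      (i == j)%:R * (b * (v 0 i / x 0 i) / x 0 j))).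
    rewrite sumrB; congr (_ - _); rewrite (bigD1 j)//= eqxx mul1r big1 ?addr0//.
    by move=> i /negPf ->; rewrite mul0r.
  move=> i _; rewrite mxE profile_partial2// -/a -/b eq_sym.
  by case: (i == j); field; rewrite !xn0.
split=> [/eqP|ab].
  rewrite mulf_eq0 invr_eq0 (expf_eq0 (normal_norm f x)).
  rewrite (gt_eqF (normal_norm_gt0 _ _)) andbF orbF.
  move=> /det0P[v v0 vH0].
  pose sigma := \sum_i v 0 i / x 0 i.
  have vj j : b * (v 0 j / x 0 j) = a * sigma.
    have : (v *m H) 0 j = 0 by rewrite vH0 mxE.
    move=> /eqP; rewrite vH mulf_eq0 invr_eq0 (negPf (xn0 j)) orbF subr_eq0.
    by move=> /eqP.
  have s0 : sigma != 0.
    apply: contra_neq v0 => s0; apply/rowP => j; rewrite mxE.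
    have /eqP := vj j; rewrite s0 mulr0 mulf_eq0 (negPf b0) mulf_eq0 invr_eq0.
    by rewrite (negPf (xn0 j)) orbF => /eqP.
  have : b * sigma = n%:R * a * sigma.
    rewrite /sigma mulr_sumr (eq_bigr _ (fun j _ => vj j)) sumr_const card_ord.
    by rewrite -[LHS]mulr_natl mulrA.
  by move=> /(mulIf s0) ->; rewrite mulKf.
suff -> : \det H = 0 by rewrite mul0r.
apply/eqP/det0P; exists x.
  apply/eqP => /rowP/(_ (Ordinal n0)); rewrite mxE => x0.
  by have := ox (Ordinal n0); rewrite x0 ltxx.
apply/rowP => j; rewrite vH mxE (eq_bigr (fun=> 1)) => [|i _]; last exact: divff.
by rewrite sumr_const card_ord divff// ab; field; rewrite nR0 xn0.
Qed.

(** The numerator [f_ii * f_jj - f_ij^2] is [p * (p - 2 * q)] up to a positive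
factor. *)
Lemma profile_sectional_curvatureP i j x : i != j -> orthant x ->
  sectional_curvature i j f x = 0 <-> q (S x) = 2^-1 * p (S x).
Proof.
move=> ij ox; rewrite sectional_curvatureE//.
set d := normal_norm f x ^+ 2 * _.
have d0 : d != 0.
  rewrite mulf_neq0// ?expf_neq0//; first by rewrite gt_eqF// normal_norm_gt0.
  by rewrite gt_eqF// -addrA ltr_pwDl// addr_ge0// sqr_ge0.
rewrite !profile_partial2// !eqxx eq_sym (negPf ij).
have := p_neq0 (S x); have := lt0r_neq0 (ox i); have := lt0r_neq0 (ox j).
move: (q _) (p _) (x 0 i) (x 0 j) => a b u v v0 u0 b0.
have -> : (a - 1%:R * b) / (u * u) * ((a - 1%:R * b) / (v * v)) -
    ((a - 0%:R * b) / (v * u)) ^+ 2 = b * (b - 2 * a) / (u * v) ^+ 2.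
  by field; rewrite u0 v0.
split=> [/eqP|->]; last by rewrite mulVKf ?subrr ?mulr0 ?mul0r.
rewrite !mulf_eq0 !invr_eq0 (negPf d0) expf_eq0/= mulf_eq0 (negPf u0) (negPf v0).
rewrite (negPf b0) !orbF/= subr_eq0 => /eqP ->.
by rewrite mulKf.
Qed.

End profile.

(** * Mean curvature *)

Section mean_curvature.
Context {R : realType} {n : nat}.
Implicit Types (f : 'rV[R]_n -> R) (x : 'rV[R]_n).

Lemma normal_norm_sqr f x :
  normal_norm f x ^+ 2 = 1 + \sum_(i < n) partial i f x ^+ 2.
Proof. by rewrite sqr_sqrtr// addr_ge0// sumr_ge0// => i _; exact: sqr_ge0. Qed.

(** Sherman-Morrison: the first fundamental form is [1 + u^T u] with [u] the
gradient, and [w^2 = 1 + u u^T]. *)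
Lemma invmx_first_form f x : differentiable f x ->
  invmx (first_form f x) =
  1%:M - normal_norm f x ^- 2 *: ((grad f x)^T *m grad f x).
Proof.
move=> df; have gU := first_form_unit df.
apply: (can_inj (mulKmx gU)); rewrite mulmxV// first_formE//.
set u := grad f x; set w2 := normal_norm f x ^+ 2.
have w20 : w2 != 0 by rewrite expf_neq0// gt_eqF// normal_norm_gt0.
have uu : u *m u^T = (w2 - 1)%:M.
  rewrite /w2 normal_norm_sqr [_ - 1]addrC addKr.
  apply/matrixP => i j; rewrite !ord1 !mxE eqxx mulr1n.
  by apply: eq_bigr => k _; rewrite !mxE expr2.
rewrite mulmxBr mulmx1 -scalemxAr mulmxDl mul1mx -!mulmxA (mulmxA u) uu.
rewrite mul_scalar_mx -scalemxAr -[X in X + (w2 - 1) *: _]scale1r -scalerDl.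
by rewrite [1 + _]addrC subrK scalerA mulVf// scale1r addrK.
Qed.

(** The trace of the Hessian times [(1 - u^T u / w^2) / w]. *)
Lemma mean_curvatureE f x : production_function f -> orthant x ->
  mean_curvature f x =
  (normal_norm f x ^+ 2 * \sum_(i < n) partial i (partial i f) x -
   \sum_(i < n) \sum_(j < n)
     partial i (partial j f) x * (partial i f x * partial j f x)) /
  (n%:R * normal_norm f x ^+ 3).
Proof.
move=> pf ox; have [_ /(_ _ ox) df _] := pf.
have w0 : normal_norm f x != 0 by rewrite gt_eqF// normal_norm_gt0.
have tr1 : \tr (second_form f x) =
    (\sum_(i < n) partial i (partial i f) x) / normal_norm f x.
  by rewrite mulr_suml; apply: eq_bigr => i _; rewrite second_formE.
have tr2 : \tr (second_form f x *m ((grad f x)^T *m grad f x)) =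
    (\sum_(i < n) \sum_(j < n)
     partial i (partial j f) x * (partial i f x * partial j f x)) /
    normal_norm f x.
  rewrite mulr_suml; apply: eq_bigr => i _.
  rewrite mulmxA mxE big_ord1 mxE !mulr_suml.
  by apply: eq_bigr => j _; rewrite second_formE// !mxE; ring.
rewrite /mean_curvature /shape_operator invmx_first_form// mulmxBr mulmx1.
rewrite -scalemxAr raddfB/= linearZ/= tr1 tr2.
move: (\sum_(i < n) _) (\sum_(i < n) _) (normal_norm f x) w0 => a b w w0.
by rewrite [in RHS]invfM [RHS]mulrCA; congr (_ * _); field.
Qed.

End mean_curvature.

(** [7 / 4 + 12] is less than [16], and [12 * k] exceeds [16] as soon as
[k >= 2]. *)
Lemma two_points_incompatible (R : realFieldType) (k : nat) : (1 <= k)%N ->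
  7 * (2 ^+ k) ^- 2 + 12 * k%:R != 16 :> R.
Proof.
case: k => [//|[_|k _]]; first by rewrite expr1; apply/eqP; lra.
have : 0 <= (2 ^+ k.+2) ^- 2 :> R by rewrite invr_ge0 sqr_ge0.
have : 2 <= k.+2%:R :> R by rewrite ler_nat.
by move=> k2 e0; rewrite gt_eqF//; lra.
Qed.

Section profile_mean.
Context {R : realType} {n : nat}.
Variables (f : 'rV[R]_n -> R) (Phi p q : R -> R).
Implicit Types (x : 'rV[R]_n) (i j : 'I_n) (s t : R).

Let S x := \sum_(i < n) ln (x 0 i).

Hypotheses (pf : production_function f) (n2 : (2 <= n)%N).
Hypothesis fPhi : forall x, orthant x -> f x = Phi (S x).
Hypothesis dPhi : forall s, is_derive s 1 Phi (p s).
Hypothesis dp : forall s, is_derive s 1 p (q s).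
Hypothesis p_neq0 : forall s, p s != 0.

Lemma profile_mean_curvature_eq0 x : orthant x -> mean_curvature f x = 0 ->
  (q (S x) - p (S x)) * (\sum_(i < n) x 0 i ^- 2) =
  p (S x) ^+ 3 * ((\sum_(i < n) x 0 i ^- 2) ^+ 2 - \sum_(i < n) x 0 i ^- 4).
Proof.
move=> ox /eqP; rewrite mean_curvatureE// mulf_eq0 invr_eq0 mulf_eq0.
rewrite (expf_eq0 (normal_norm f x)) (gt_eqF (normal_norm_gt0 _ _)) andbF orbF.
rewrite pnatr_eq0 (gtn_eqF (ltnW n2)) orbF normal_norm_sqr.
set a := q _; set b := p _; set S1 := \sum_(i < n) x 0 i ^- 2.
set S2 := \sum_(i < n) x 0 i ^- 4.
have x0 i := lt0r_neq0 (ox i).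
have partialE i : partial i f x = b / x 0 i := profile_partial fPhi dPhi i ox.
have partial2E i j : partial j (partial i f) x =
    (a - (i == j)%:R * b) / (x 0 i * x 0 j) :=
  profile_partial2 fPhi dPhi dp i j ox.
have -> : \sum_(i < n) partial i f x ^+ 2 = b ^+ 2 * S1.
  rewrite mulr_sumr; apply: eq_bigr => i _.
  by rewrite partialE expr_div_n.
have -> : \sum_(i < n) partial i (partial i f) x = (a - b) * S1.
  rewrite mulr_sumr; apply: eq_bigr => i _.
  by rewrite partial2E eqxx mul1r -expr2.
have -> : \sum_(i < n) \sum_(j < n)
    partial i (partial j f) x * (partial i f x * partial j f x) =
    b ^+ 2 * a * S1 ^+ 2 - b ^+ 3 * S2.
  have -> : b ^+ 2 * a * S1 ^+ 2 - b ^+ 3 * S2 =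
      \sum_(i < n) (b ^+ 2 * a * x 0 i ^- 2 * S1 - b ^+ 3 * x 0 i ^- 4).
    by rewrite sumrB -mulr_suml -!mulr_sumr -/S1 -/S2; ring.
  apply: eq_bigr => i _; rewrite mulr_sumr.
  rewrite (eq_bigr (fun j => b ^+ 2 * a * x 0 i ^- 2 * x 0 j ^- 2 -
     (j == i)%:R * (b ^+ 3 * x 0 i ^- 4))).
    rewrite sumrB; congr (_ - _); rewrite (bigD1 i)//= eqxx mul1r big1 ?addr0//.
    by move=> j /negPf ->; rewrite mul0r.
  move=> j _; rewrite partial2E !partialE.
  by have [->|_] := eqVneq j i; rewrite ?eqxx /=; field; rewrite !x0.
by move=> /eqP e; apply/eqP; rewrite -subr_eq0 -e; apply/eqP; ring.
Qed.

(** The points [(1, ..., 1)] and [(2^m, 1/2, ..., 1/2)], with [m = n - 1], have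
the same product of coordinates, so [p] and [q] take the same values at both.
The first point gives [q - p = p^3 * m].  At the second one, with [e = 4^(- m)],
the two sums are [e + 4 m] and [e^2 + 16 m]; eliminating [q - p] leaves
[p^3 * m * (7 e + 12 m - 16) = 0], although no factor vanishes. *)
Lemma profile_not_minimal : ~ minimal_hypersurface f.
Proof.
move=> fmin.
pose m := n.-1; have nE : m.+1 = n by rewrite prednK// ltnW.
have nR : n%:R = m%:R + 1 :> R by rewrite natr1 nE.
pose i0 := Ordinal (ltnW n2).
pose one : 'rV[R]_n := const_mx 1.
pose y : 'rV[R]_n := \row_l (if l == i0 then 2 ^+ m else 2^-1).
have oone : orthant one by move=> l; rewrite mxE.
have oy : orthant y by move=> l; rewrite mxE; case: ifP.
have sumy (phi : R -> R) :
    \sum_(l < n) phi (y 0 l) = phi (2 ^+ m) + m%:R * phi 2^-1.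
  rewrite (bigD1 i0)//= mxE eqxx; congr (_ + _).
  rewrite (eq_bigr (fun=> phi 2^-1)) => [|l /negPf li]; last by rewrite mxE li.
  rewrite sumr_const -[LHS]mulr_natl; congr (_ * _).
  by rewrite (cardC1 i0) card_ord.
have sum1 (phi : R -> R) : \sum_(l < n) phi (one 0 l) = n%:R * phi 1.
  rewrite (eq_bigr (fun=> phi 1)) => [|l _]; last by rewrite mxE.
  by rewrite sumr_const card_ord mulr_natl.
have Sone : S one = 0 by rewrite /S (sum1 (@ln R)) ln1 mulr0.
have Sy : S y = 0.
  rewrite /S (sumy (@ln R)) lnXn// lnV ?posrE// mulrN mulr_natl.
  by rewrite subrr.
have := profile_mean_curvature_eq0 oone (fmin _ oone).
have := profile_mean_curvature_eq0 oy (fmin _ oy).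
rewrite Sone Sy (sumy (fun t => t ^- 2)) (sumy (fun t => t ^- 4)).
rewrite (sum1 (fun t => t ^- 2)) (sum1 (fun t => t ^- 4)).
pose e : R := (2 ^+ m) ^- 2.
have -> : (2 ^+ m) ^- 4 = e ^+ 2 :> R by rewrite /e exprVn -[in RHS]exprM.
have := p_neq0 0; rewrite -/e !expr1n invr1 !mulr1 nR.
rewrite -!exprVn !invrK.
have ne16 : 7 * e + 12 * m%:R != 16.
  by apply: two_points_incompatible; rewrite -ltnS nE.
have m0 : m%:R != 0 :> R by rewrite pnatr_eq0 -lt0n -ltnS nE.
have m1 : m%:R + 1 != 0 :> R by rewrite -nR pnatr_eq0 -lt0n ltnW.
move: (q 0) (p 0) m%:R e m0 m1 ne16 => a b M E M0 M1 ne b0 eq2 eq1.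
have D : a - b = b ^+ 3 * M.
  apply: (mulIf M1); rewrite eq1; ring.
move: eq2; rewrite D => /eqP; rewrite -subr_eq0.
have -> : b ^+ 3 * M * (E + M * 2 ^+ 2) -
    b ^+ 3 * ((E + M * 2 ^+ 2) ^+ 2 - (E ^+ 2 + M * 2 ^+ 4)) =
    - (b ^+ 3 * M * (7 * E + 12 * M - 16)) by ring.
by rewrite oppr_eq0; apply/negP; rewrite !mulf_neq0 ?expf_neq0 ?subr_eq0.
Qed.

End profile_mean.

(** * The theorem *)

Theorem theorem0p1 (R : realType) (n : nat) (hn : (2 <= n)%N)
    (f : 'rV[R]_n -> R) (G : R -> R) (h : 'I_n -> R -> R)
    (hf : production_function f) (hq : quasi_sum G h f) :
  (forall (i : 'I_n) (k : R),
     constant_elasticity i f k <->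
     exists A D : R, 0 < A /\ 0 < D /\
       forall x, orthant x ->
         f x = A * (x 0 i `^ k) * expR (D * \sum_(j < n | j != i) h j (x 0 j)))
  /\
  (((exists k : 'I_n -> R,
       forall i, 0 < k i /\ constant_elasticity i f (k i)) <->
    (exists (A : R) (alpha : 'I_n -> R), 0 < A /\ (forall i, 0 < alpha i) /\
       forall x, orthant x -> f x = A * \prod_(i < n) (x 0 i `^ alpha i)))
   /\
   ((exists k : 'I_n -> R, forall i, constant_elasticity i f (k i)) <->
    (exists (A : R) (alpha : 'I_n -> R), 0 < A /\ (forall i, alpha i != 0) /\
       forall x, orthant x -> f x = A * \prod_(i < n) (x 0 i `^ alpha i))))
  /\
  (proportional_MRS f <->
   exists (k : R) (F : R -> R), k != 0 /\
     (forall u v : R, 0 < u -> u < v -> F u < F v) /\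
     forall x, orthant x -> f x = F (\prod_(i < n) (x 0 i `^ k)))
  /\
  (proportional_MRS f ->
     ((forall x, orthant x -> gauss_kronecker f x = 0) <->
      exists A c : R, 0 < A /\
        forall x, orthant x ->
          f x = A * \prod_(i < n) (x 0 i `^ n%:R^-1) + c)
     /\
     ~ minimal_hypersurface f
     /\
     ((forall (i j : 'I_n), i != j ->
         forall x, orthant x -> sectional_curvature i j f x = 0) <->
      exists A c : R, 0 < A /\
        forall x, orthant x ->
          f x = A * \prod_(i < n) Num.sqrt (x 0 i) + c)).
Proof.
have [J [[oJ iJ] _ dG mh JfE]] := hq.
have JU x (ox : orthant x) := (JfE x ox).1.
have fE x (ox : orthant x) := (JfE x ox).2.
have n0 : (0 < n)%N := ltnW hn.
split; first by move=> i k; exact: (constant_elasticityP hf oJ iJ dG mh JU fE).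
split.
  split; split.
  - move=> [k fk]; have /(cobb_douglas_elasticityP k hf)[A A0 fA] :
      forall i, constant_elasticity i f (k i) by move=> i; case: (fk i).
    by exists A, k; split=> //; split=> // i; case: (fk i).
  - move=> [A [alpha [A0 [alpha0 fA]]]]; exists alpha => i; split=> //.
    by apply: (iffRL (cobb_douglas_elasticityP alpha hf)); exists A.
  - move=> [k fk]; have /(cobb_douglas_elasticityP k hf)[A A0 fA] := fk.
    exists A, k; split=> //; split=> // i.
    exact: (constant_elasticity_neq0 hf oJ iJ dG mh JU fE (fk i)).
  - move=> [A [alpha [A0 [_ fA]]]]; exists alpha => i.
    by apply: (iffRL (cobb_douglas_elasticityP alpha hf)); exists A.
split; first exact: (homotheticP hf oJ iJ dG mh JU fE).
move=> /(log_sum_profile hf oJ iJ dG mh JU fE hn)[Phi [p [q [fPhi dPhi dp p0]]]].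
split; last split.
- have r0 : 0 < n%:R^-1 :> R by rewrite invr_gt0 ltr0n.
  rewrite -(profile_powerP hf n0 fPhi dPhi dp p0 r0).
  split=> [gk|qE x ox]; last by apply/(profile_gauss_kroneckerP hf n0 fPhi dPhi).
  apply/(forall_profile n0 (fun s => q s = n%:R^-1 * p s)) => x ox.
  by apply/(profile_gauss_kroneckerP hf n0 fPhi dPhi dp p0 ox)/gk.
- exact: (profile_not_minimal hf hn fPhi dPhi dp p0).
have sqrtE x : orthant x ->
    \prod_(i < n) Num.sqrt (x 0 i) = \prod_(i < n) (x 0 i `^ 2^-1).
  by move=> ox; apply: eq_bigr => i _; rewrite powR12_sqrt// ltW//; exact: ox.
have r0 : 0 < 2^-1 :> R by rewrite invr_gt0.
have -> : (exists A c : R, 0 < A /\ forall x, orthant x ->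
      f x = A * \prod_(i < n) Num.sqrt (x 0 i) + c) <->
    (exists A c : R, 0 < A /\ forall x, orthant x ->
      f x = A * \prod_(i < n) (x 0 i `^ 2^-1) + c).
  by split=> -[A [c [A0 fA]]]; exists A, c; split=> // x ox; rewrite fA// sqrtE.
rewrite -(profile_powerP hf n0 fPhi dPhi dp p0 r0).
split=> [K0|qE i j ij x ox].
  apply/(forall_profile n0 (fun s => q s = 2^-1 * p s)) => x ox.
  have ij : Ordinal n0 != Ordinal hn by [].
  exact/(profile_sectional_curvatureP hf fPhi dPhi dp p0 ij ox)/K0.
exact/(profile_sectional_curvatureP hf fPhi dPhi dp p0 ij ox)/qE.
Qed.
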